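(* Let $m,n$ be positive integers, let $L\in\mathcal{D}(B^m,B^n)$, let $f:B^m\to B^n$ be a function, and let $b\in B^m$. Then $L$ is a differential of $f$ at $b$ if and only if one of the following holds: (1) $L$ is isolated and $L(x)=f(x)$ for every $x\in N(b)$; (2) $L$ is not isolated but constant, $f(N(b))\subseteq N(0_n)$, and $f(0_m)=0_n$ if $0_m\in N(b)$; or (3) $L$ is not isolated and not constant, there exists a unique $\beta\in N(0_n)\setminus\{0_n\}$ such that $f(N(b))\subseteq L(B^m)=\{0_n,\beta\}$, and $f(0_m)=0_n$ if $0_m\in N(b)$.
   Context: The $n$-Boolean hypercube $B^n$ is the set $\{0,1\}^n=\bigoplus_{i=1}^n\mathbb{Z}_2$ regarded as the Cayley graph with generators the standard basis vectors: its graph neighborhoods are $N(a)=\{c\in\{0,1\}^n: c \text{ differs from } a \text{ in at most one coordinate}\}$, and a filter $\mathcal{F}$ converges to $a$ iff $N(a)\in\mathcal{F}$. $0_n$ denotes the zero vector. For reflexive digraphs, continuous maps are maps $g$ with $g(N(v))\subseteq N(g(v))$, and the space of continuous maps is a reflexive digraph with $g\in N(h)$ iff $g(x)\in N(h(y))$ whenever $x\in N(y)$. $\mathcal{D}(B^m,B^n)$ is the set of $\mathbb{Z}_2$-linear maps $B^m\to B^n$ that are continuous, with neighborhoods induced from the function-space digraph. $L$ is isolated if $N(L)\cap\mathcal{D}(B^m,B^n)=\{L\}$; constant means $L\equiv 0_n$. Differential: $L$ is a differential of $f$ at $b$ iff for every filter $\mathcal{A}\to b$ there is a filter $\mathcal{L}$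 on $\mathcal{D}(B^m,B^n)$ converging to $L$ (i.e. containing $N(L)\cap\mathcal{D}(B^m,B^n)$) such that for every $K\in\mathcal{L}$ there is $A\in\mathcal{A}$ with $f(x)\in\{k(x):k\in K\}$ for every $x\in A$. *)

(* Defs.v *)
From HB Require Import structures.
From mathcomp Require Import all_boot all_order all_algebra.
From mathcomp Require Import boolp classical_sets filter.
Set Implicit Arguments.
Unset Strict Implicit.
Unset Printing Implicit Defensive.
Import GRing.Theory.
Local Open Scope classical_set_scope.
Local Open Scope ring_scope.

(* A digraph on V is given by its neighborhood map N : V -> set V. *)
Section Digraph.
Context {V W : Type}.

Definition filter_to (N : V -> set V) (F : set_system V) (a : V) : Prop :=
  F (N a).

Definition digraph_continuous (NV : V -> set V) (NW : W -> set W)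
    (g : V -> W) : Prop :=
  forall v, g @` NV v `<=` NW (g v).

Definition fun_nbhd (NV : V -> set V) (NW : W -> set W)
    (h : V -> W) : set (V -> W) :=
  [set g | digraph_continuous NV NW g /\
           forall x y, NV y x -> NW (h y) (g x)].

End Digraph.

Notation cube n := 'rV['F_2]_n.

Definition cube_nbhd {n : nat} (a : cube n) : set (cube n) :=
  [set c | (#|[pred i | c ord0 i != a ord0 i]| <= 1)%N].

(* As a set, D m n coerces to the type set_type (D m n) of its elements, and
   sval is the inclusion of that type into cube m -> cube n. *)
Definition D (m n : nat) : set (cube m -> cube n) :=
  [set g | linear g /\ digraph_continuous cube_nbhd cube_nbhd g].

Arguments D : clear implicits.

Section Differential.
Context {m n : nat}.

Definition D_nbhd (L : D m n) : set (D m n) :=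
  [set g : D m n | fun_nbhd cube_nbhd cube_nbhd (sval L) (sval g)].

Definition isolated (L : D m n) : Prop := D_nbhd L = [set L].

Definition constant_zero (L : D m n) : Prop := forall x, sval L x = 0.

Definition differential (f : cube m -> cube n) (b : cube m) (L : D m n) :
    Prop :=
  forall A : set_system (cube m), ProperFilter A -> filter_to cube_nbhd A b ->
  exists F : set_system (D m n),
    [/\ ProperFilter F, filter_to D_nbhd F L &
        forall K, F K ->
        exists2 S, A S & forall x, S x -> [set sval k x | k in K] (f x)].

End Differential.

(* Main.v *)
Require Import Defs.
From HB Require Import structures.
From mathcomp Require Import all_boot all_order all_algebra.
From mathcomp Require Import boolp classical_sets filter.
Set Implicit Arguments.
Unset Strict Implicit.
Unset Printing Implicit Defensive.
Import GRing.Theory.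
Local Open Scope classical_set_scope.
Local Open Scope ring_scope.

(* Testing against principal filters reduces "L is a differential of f at b" to
   the pointwise condition that every x in N(b) has some k in N(L) with
   k x = f x. If g in N(L) differs from L, say g y - L y = beta <> 0, then
   beta has weight one, and since a subspace of B^n all of whose vectors have
   weight at most one is contained in some {0, beta}, both g and L take their
   values in {0, beta}. Conversely, if L takes its values in {0, beta} with
   beta in N(0), then N(L) contains every linear map with values in {0, beta};
   at a nonzero x the maps z |-> z_i beta and 0 attain both values. *)

Lemma F2_eq0_or1 (a : 'F_2) : a = 0 \/ a = 1.
Proof. by case: a => -[|[|//]] lta; [left | right]; apply: val_inj. Qed.

Lemma cube_addvv n (v : cube n) : v + v = 0.
Proof.
apply/rowP => i; rewrite !mxE.
by have [->|->] := F2_eq0_or1 (v ord0 i); [rewrite addr0 | apply: val_inj].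
Qed.

Lemma cube_oppv n (v : cube n) : - v = v.
Proof. by apply: (addrI v); rewrite subrr cube_addvv. Qed.

Lemma cube_nbhdP n (a c : cube n) :
  cube_nbhd a c <->
  forall i j, c ord0 i != a ord0 i -> c ord0 j != a ord0 j -> i = j.
Proof.
split=> [/card_le1_eqP h i j ci cj|h]; first exact: h.
by apply/card_le1_eqP => i j ci cj; apply: h.
Qed.

Lemma cube_nbhd_sub n (a c : cube n) : cube_nbhd a c <-> cube_nbhd 0 (c - a).
Proof.
by split=> /cube_nbhdP h; apply/cube_nbhdP => i j; have := h i j;
   rewrite !mxE !subr_eq0.
Qed.

Lemma cube_nbhd0 n : cube_nbhd (0 : cube n) 0.
Proof. by apply/cube_nbhdP => i j; rewrite eqxx. Qed.

(** Nonzero [u] and [v] of weight one are basis vectors; if these were distinct, [v + u] would have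
    weight two. *)
Lemma cube_nbhd0_line n (u v : cube n) :
  u != 0 -> cube_nbhd 0 u -> cube_nbhd 0 v -> cube_nbhd 0 (v + u) ->
  v = 0 \/ v = u.
Proof.
move=> /rV0Pn[i ui] /cube_nbhdP hu /cube_nbhdP hv /cube_nbhdP huv.
have [->|/rV0Pn[j vj]] := eqVneq v 0; [by left | right].
have {}hu k : k != i -> u ord0 k = 0.
  move=> ki; apply/eqP; apply/contraT => uk; case/eqP: ki.
  by apply: hu; rewrite mxE.
have {}hv k : k != j -> v ord0 k = 0.
  move=> kj; apply/eqP; apply/contraT => vk; case/eqP: kj.
  by apply: hv; rewrite mxE.
have ij : i = j.
  have [//|neq] := eqVneq i j; apply: huv; rewrite !mxE.
    by rewrite hv // add0r.
  by rewrite (hu j) ?addr0 // eq_sym.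
subst j; apply/rowP => k; have [->|ki] := eqVneq k i; last by rewrite hu // hv.
by case: (F2_eq0_or1 (u ord0 i)) ui => -> //; case: (F2_eq0_or1 (v ord0 i)) vj => ->.
Qed.

(** Over ['F_2] this is the subspace spanned by [beta]. *)
Definition line n (beta : cube n) : set (cube n) := [set 0; beta].

Lemma line_add n (beta u v : cube n) :
  line beta u -> line beta v -> line beta (u + v).
Proof.
by case=> -> [] ->; rewrite ?addr0 ?add0r ?cube_addvv; [left|right|right|left].
Qed.

Lemma line_sub n (beta u v : cube n) :
  line beta u -> line beta v -> line beta (u - v).
Proof. by rewrite cube_oppv; apply: line_add. Qed.

Lemma line_scale n (beta : cube n) a v : line beta v -> line beta (a *: v).
Proof.
by case: (F2_eq0_or1 a) => ->; rewrite ?scale0r ?scale1r //; left.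
Qed.

Lemma line_nbhd n (beta u v : cube n) :
  cube_nbhd 0 beta -> line beta u -> line beta v -> cube_nbhd u v.
Proof.
move=> hb hu hv; apply/cube_nbhd_sub.
by case: (line_sub hv hu) => ->; [apply: cube_nbhd0|].
Qed.

Section DifferentialCriterion.
Variables m n : nat.
Implicit Types (L g : D m n) (f : cube m -> cube n).

Lemma D_linear g : exists h : {linear cube m -> cube n}, sval g = h.
Proof.
case: g => g /= gD; have [glin _] := set_mem gD.
pose h : {linear cube m -> cube n} :=
  HB.pack g (GRing.isLinear.Build _ _ _ _ g glin).
by exists h.
Qed.

Lemma D_eval0 g : sval g 0 = 0.
Proof. by have [h ->] := D_linear g; rewrite linear0. Qed.

Lemma D_continuous g x y : cube_nbhd y x -> cube_nbhd (sval g y) (sval g x).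
Proof. by case: g => g /= /set_mem[_ gc] xy; apply: gc; exists x. Qed.

Lemma D_nbhd_self L : D_nbhd L L.
Proof.
split; last by move=> x y; apply: D_continuous.
by move=> v _ [x xv <-]; apply: D_continuous.
Qed.

Lemma cube_nbhd_delta (y : cube m) i : cube_nbhd y (y + delta_mx 0 i).
Proof.
apply/cube_nbhd_sub; rewrite addrC addKr; apply/cube_nbhdP => j k.
by rewrite !mxE !eqxx /=; have [->|] := eqVneq j i; have [->|] := eqVneq k i.
Qed.

Lemma D_nbhd_pointwise L g x : D_nbhd L g -> cube_nbhd (sval L x) (sval g x).
Proof. by case=> _; apply; apply/cube_nbhd_sub; rewrite subrr; apply: cube_nbhd0. Qed.

Lemma D_nbhd_line L g :
  D_nbhd L g -> g <> L ->
  exists beta, [/\ (cube_nbhd 0 `\ 0) beta,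
    (forall x, line beta (sval L x)) & (forall x, line beta (sval g x))].
Proof.
move=> gL gnL; have /existsNP[y /eqP gLy] : ~ forall y, sval g y = sval L y.
  by move=> h; apply: gnL; apply: val_inj; apply/funext.
pose beta := sval g y - sval L y; exists beta.
have beta0 : beta != 0 by rewrite subr_eq0.
have diffN x : cube_nbhd 0 (sval g x - sval L x).
  exact: (cube_nbhd_sub _ _).1 (D_nbhd_pointwise x gL).
have [h hE] := D_linear g; have [l lE] := D_linear L.
(* Basis vectors suffice for [g], because [line beta] is a subspace. *)
have hdelta i : line beta (h (delta_mx 0 i)).
  apply: cube_nbhd0_line => //; first exact: diffN.
    rewrite -hE -(D_eval0 g); apply: D_continuous.
    by rewrite -[X in cube_nbhd _ X]add0r; apply: cube_nbhd_delta.
  (* Write [e] for the [i]-th basis vector. Since [y + e] is adjacent to [y], [g (y + e)] lies in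
     the neighborhood of [L y], and [g (y + e) - L y = h e + beta]. *)
  have /cube_nbhd_sub := gL.2 _ _ (cube_nbhd_delta y i).
  by rewrite /beta hE linearD [h y + _]addrC addrA.
have hline x : line beta (sval g x).
  rewrite hE (row_sum_delta x) linear_sum.
  apply: big_ind => [|u v|i _]; [by left | exact: line_add |].
  by rewrite linearZ; apply: line_scale.
(* By linearity, adding [beta] to the difference of [g] and [L] at [x] gives their difference at
   [x + y], again of weight at most one. *)
have diffline x : line beta (sval g x - sval L x).
  apply: cube_nbhd0_line => //; first exact: diffN.
  by rewrite /beta addrACA -opprD hE lE -!linearD -hE -lE; apply: diffN.
split=> //; first by split; [apply: diffN | apply/eqP].
move=> x; rewrite -[sval L x](subKr (sval g x)).
by apply: line_sub.
Qed.

(** Any two points of [line beta] are adjacent, so both the continuity of [g] and its adjacency to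
    [L] are automatic. *)
Lemma linear_line_D_nbhd L (beta : cube n) (g : {linear cube m -> cube n}) :
  cube_nbhd 0 beta -> (forall x, line beta (sval L x)) ->
  (forall x, line beta (g x)) ->
  exists2 k, D_nbhd L k & sval k = g.
Proof.
move=> bN Ll gl.
have gc : digraph_continuous cube_nbhd cube_nbhd g.
  by move=> v _ [x _ <-]; apply: line_nbhd bN _ _.
have gD : D m n g by split=> // a u v; rewrite linearP.
exists (SigSub (mem_set gD)) => //; split=> //= x y _.
exact: line_nbhd bN _ _.
Qed.

Lemma D_nbhd_line_eval L (beta c : cube n) (x : cube m) :
  cube_nbhd 0 beta -> (forall x, line beta (sval L x)) ->
  line beta c -> (x = 0 -> c = 0) ->
  exists2 k, D_nbhd L k & sval k x = c.
Proof.
move=> bN Ll cl c0.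
have [->|cn0] := eqVneq c 0.
  have [|k kL kE] := linear_line_D_nbhd (g := \0) bN Ll; first by left.
  by exists k; rewrite ?kE.
have cE : c = beta by case: cl cn0 => ->; rewrite ?eqxx.
have /rV0Pn[i xi] : x != 0 by apply: contra_neq cn0.
(* Right multiplication by this rank-one matrix is [z |-> z_i beta]; the index [i] was chosen with
   [x_i] nonzero, hence equal to 1. *)
have [|k kL kE] := linear_line_D_nbhd
    (g := mulmxr (delta_mx i 0 *m beta)) bN Ll.
  move=> z; rewrite /= mulmxA -colE (mx11_scalar (col i z)) mul_scalar_mx.
  by apply: line_scale; right.
exists k => //; rewrite kE /= mulmxA -colE (mx11_scalar (col i x)).
rewrite mul_scalar_mx mxE cE.
by case: (F2_eq0_or1 (x ord0 i)) xi => -> // _; rewrite scale1r.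
Qed.

(* Principal filters: at x in one direction, generated by N(L) in the other. *)
Lemma differentialP f b L :
  differential f b L <->
  forall x, cube_nbhd b x -> exists2 k, D_nbhd L k & sval k x = f x.
Proof.
split=> [dfL x bx|h A _ bA].
  have bP : filter_to cube_nbhd (principal_filter x) b by apply/principal_filterP.
  have [F [_ FL FK]] := dfL _ (principal_filter_proper x) bP.
  by have [S /principal_filterP Sx /(_ x Sx)] := FK _ FL.
exists [set K | D_nbhd L `<=` K]; split; last first.
- by move=> K LK; exists (cube_nbhd b) => // x /h[k kL kx]; exists k => //; apply: LK.
- by [].
- split; first by move=> /(_ L (D_nbhd_self L)).
  split=> [|P Q LP LQ k kL|P Q PQ LP k kL]; first by [].
    by split; [apply: LP | apply: LQ].
  exact/PQ/LP.
Qed.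

End DifferentialCriterion.

Theorem theorem5p4 (m n : nat) (hm : (0 < m)%N) (hn : (0 < n)%N)
    (L : D m n) (f : cube m -> cube n) (b : cube m) :
  differential f b L <->
  [\/ isolated L /\ (forall x, cube_nbhd b x -> sval L x = f x),
      [/\ ~ isolated L, constant_zero L,
          f @` cube_nbhd b `<=` cube_nbhd 0 &
          (cube_nbhd b 0 -> f 0 = 0)] |
      [/\ ~ isolated L, ~ constant_zero L,
          (exists! beta : cube n,
             [/\ (cube_nbhd 0 `\ 0) beta,
                 f @` cube_nbhd b `<=` range (sval L) &
                 range (sval L) = [set 0; beta]]) &
          (cube_nbhd b 0 -> f 0 = 0)]].
Proof.
split=> [/differentialP dfL|].
  have f0 : cube_nbhd b 0 -> f 0 = 0.
    by move=> /dfL[k _ <-]; apply: D_eval0.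
  have [iL|niL] := pselect (isolated L).
    by constructor 1; split=> // x /dfL[k]; rewrite iL => ->.
  have [L0|nL0] := pselect (constant_zero L).
    constructor 2; split=> // _ [x /dfL[k kL <-] <-].
    by rewrite -(L0 x); apply: D_nbhd_pointwise.
  (* A second neighbor of [L] exists because [L] is always its own neighbor; it confines [L] to a
     line. *)
  have [g gL gnL] : exists2 g, D_nbhd L g & g <> L.
    apply: contrapT => h; apply: niL; apply/seteqP; split=> [g gL|_ ->].
      by apply: contrapT => gnL; apply: h; exists g.
    exact: D_nbhd_self.
  have [beta [betaN Ll _]] := D_nbhd_line gL gnL.
  have /existsNP[y Ly0] := nL0.
  have Ly : sval L y = beta by case: (Ll y).
  have rangeL : range (sval L) = [set 0; beta].
    apply/seteqP; split=> [_ [x _ <-]|_ [->|->]]; first exact: Ll.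
      by exists 0 => //; apply: D_eval0.
    by exists y.
  constructor 3; split=> //; exists beta; split; first split=> //.
    move=> _ [x /dfL[k kL <-] <-].
    have [->|knL] := pselect (k = L); first by exists x.
    (* Each neighbor [k] brings its own line, but the nonzero value [L y] lies on that line as well,
       so all these lines coincide. *)
    have [gamma [_ Ll' kl]] := D_nbhd_line kL knL.
    rewrite rangeL.
    have <- : gamma = beta by rewrite -Ly; case: (Ll' y).
    exact: kl.
  move=> gamma [_ _ rangeL'].
  have : range (sval L) beta by exists y.
  by rewrite rangeL' => -[e|//]; case: betaN => _ /(_ e).
case=> [[_ Lf]|[_ L0 fN f0]|[_ _ [beta [[[bN _] fL rangeL] _]] f0]];
    apply/differentialP => x bx.
- by exists L; [apply: D_nbhd_self | apply: Lf].
(* The zero map takes its values in every line, so the line may vary with [x] and is chosen through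
   [f x]. *)
- apply: (D_nbhd_line_eval (beta := f x)).
  + by apply: fN; exists x.
  + by move=> z; left; apply: L0.
  + by right.
  + by move=> x0; move: bx; rewrite x0; apply: f0.
- apply: (D_nbhd_line_eval bN).
  + by move=> z; rewrite /line -rangeL; exists z.
  + by rewrite /line -rangeL; apply: fL; exists x.
  + by move=> x0; move: bx; rewrite x0; apply: f0.
Qed.
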